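(* Let $m\ge1$ be an integer, let $\boldsymbol{\Psi},\boldsymbol{\Omega}\in\mathcal{S}_m$ be fixed matrices with $\boldsymbol{\Omega}>\boldsymbol{\Psi}$, and for $i=1,2,3$ let $\boldsymbol{X}_i\sim MBGi_m(a,b,h,\boldsymbol{\Phi})$ and $$\boldsymbol{Y}_i=(\boldsymbol{\Omega}-\boldsymbol{\Psi})^{\frac12}\boldsymbol{X}_i(\boldsymbol{\Omega}-\boldsymbol{\Psi})^{\frac12}+\boldsymbol{\Psi}.$$ Then the density functions of $\boldsymbol{Y}_1,\boldsymbol{Y}_2,\boldsymbol{Y}_3$ are respectively $$f(\boldsymbol{Y}_1)=\zeta_{a,b}^{(1)}\det(\boldsymbol{Y}_1-\boldsymbol{\Psi})^{a-\frac12(m+1)}\det(\boldsymbol{\Omega}-\boldsymbol{Y}_1)^{b-\frac12(m+1)}\det(\boldsymbol{\Omega}-\boldsymbol{\Psi})^{-(a+b)+\frac12(m+1)}\,h\left(\mathrm{tr}\,\boldsymbol{\Theta}(\boldsymbol{Y}_1-\boldsymbol{\Psi})\right),$$ $$f(\boldsymbol{Y}_2)=\zeta_{a,b}^{(2)}\det(\boldsymbol{Y}_2-\boldsymbol{\Psi})^{a-\frac12(m+1)}\det(\boldsymbol{\Omega}+\boldsymbol{Y}_2-2\boldsymbol{\Psi})^{-(a+b)}\det(\boldsymbol{\Omega}-\boldsymbol{\Psi})^{b}\,h\left(\mathrm{tr}\,\boldsymbol{\Theta}(\boldsymbol{Y}_2-\boldsymbol{\Psi})\right),$$ $$f(\boldsymbol{Y}_3)=\zeta_{a,b}^{(3)}\det(\boldsymbol{Y}_3-\boldsymbol{\Psi})^{a-\frac12(m+1)}\det(\boldsymbol{\Omega}-\boldsymbol{Y}_3)^{b-\frac12(m+1)}\det(\boldsymbol{\Omega}+\boldsymbol{Y}_3-2\boldsymbol{\Psi})^{-(a+b)}\det(\boldsymbol{\Omega}-\boldsymbol{\Psi})^{\frac12(m+1)}\,h\left(\mathrm{tr}\,\boldsymbol{\Theta}(\boldsymbol{Y}_3-\boldsymbol{\Psi})\right),$$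 where $\boldsymbol{\Psi}<\boldsymbol{Y}_i<\boldsymbol{\Omega}$ for $i=1,2,3$, and $\boldsymbol{\Theta}=(\boldsymbol{\Omega}-\boldsymbol{\Psi})^{-\frac12}\boldsymbol{\Phi}(\boldsymbol{\Omega}-\boldsymbol{\Psi})^{-\frac12}$.
   Context: Let $\mathcal{S}_m$ be the set of $m\times m$ real symmetric positive definite matrices and $\mathcal{I}_m=\{\boldsymbol{X}\in\mathcal{S}_m:\boldsymbol{I}_m-\boldsymbol{X}\in\mathcal{S}_m\}$. For symmetric matrices, $\boldsymbol{A}>\boldsymbol{B}$ (Löwner order) means $\boldsymbol{A}-\boldsymbol{B}\in\mathcal{S}_m$. Square roots of positive definite matrices are the positive definite ones. Densities are with respect to Lebesgue measure $d\boldsymbol{X}=\prod_{i\le j}dx_{ij}$ on symmetric matrices. The parameters satisfy $\mathrm{Re}(a)>(m-1)/2$ and $\mathrm{Re}(b)>(m-1)/2$; $\boldsymbol{\Phi}$ is a symmetric complex $m\times m$ matrix; $h$ is a Borel measurable function admitting a Taylor series expansion, in the sense that $h(\mathrm{tr}(\boldsymbol{\Phi}\boldsymbol{X}))=\sum_{t=0}^\infty \frac{h^{(t)}(0)}{t!}(\mathrm{tr}\,\boldsymbol{\Phi}\boldsymbol{X})^t$ on the support. The random symmetric matrix $\boldsymbol{X}$ has the distribution $MBGi_m(a,b,h,\boldsymbol{\Phi})$ (matrix variate beta type $i$ generator distribution) if its density is, respectively: - $i=1$: $f(\boldsymbol{X})=\zeta_{a,b}^{(1)}\det(\boldsymbol{X})^{a-\frac12(m+1)}\det(\boldsymbol{I}_m-\boldsymbol{X})^{b-\frac12(m+1)}h(\mathrm{tr}(\boldsymbol{\Phi}\boldsymbol{X}))$,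 $\boldsymbol{X}\in\mathcal{I}_m$; - $i=2$: $f(\boldsymbol{X})=\zeta_{a,b}^{(2)}\det(\boldsymbol{X})^{a-\frac12(m+1)}\det(\boldsymbol{I}_m+\boldsymbol{X})^{-(a+b)}h(\mathrm{tr}(\boldsymbol{\Phi}\boldsymbol{X}))$, $\boldsymbol{X}\in\mathcal{S}_m$; - $i=3$: $f(\boldsymbol{X})=\zeta_{a,b}^{(3)}\det(\boldsymbol{X})^{a-\frac12(m+1)}\det(\boldsymbol{I}_m-\boldsymbol{X})^{b-\frac12(m+1)}\det(\boldsymbol{I}_m+\boldsymbol{X})^{-(a+b)}h(\mathrm{tr}(\boldsymbol{\Phi}\boldsymbol{X}))$, $\boldsymbol{X}\in\mathcal{I}_m$; where $\zeta_{a,b}^{(i)}$ is the normalizing constant making $f$ integrate to $1$.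
   Formalization: For i=2 the stated range Ψ<Y₂<Ω is false, since X₂ ranges over all positive definite matrices; the formal statement gives the same density formula for Y₂ on the full support Y₂>Ψ instead. *)

(* Defs.v *)
From HB Require Import structures.
From mathcomp Require Import all_boot all_order all_algebra.
From mathcomp Require Import complex.
From mathcomp Require Import all_classical all_reals all_analysis.
Set Implicit Arguments.
Unset Strict Implicit.
Unset Printing Implicit Defensive.
Import Order.TTheory GRing.Theory Num.Theory numFieldNormedType.Exports.
Local Open Scope classical_set_scope.
Local Open Scope ring_scope.

(** Borel sigma-algebra on matrices: the one generated by the entries. *)

Definition measure_mx_display : measure_display -> measure_display.
Proof. exact. Qed.

Section measurable_mx.
Context {d} {T : measurableType d}.
Variables m n : nat.

Definition mx_cylinders : set (set 'M[T]_(m, n)) :=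
  \bigcup_(p in [set: 'I_m * 'I_n])
    preimage_set_system setT (fun M : 'M[T]_(m, n) => M p.1 p.2) measurable.

Let mx_set0 : <<s mx_cylinders >> set0.
Proof. exact: sigma_algebra0. Qed.

Let mx_setC A : <<s mx_cylinders >> A -> <<s mx_cylinders >> (~` A).
Proof. exact: sigma_algebraC. Qed.

Let mx_bigcup (F : (set 'M[T]_(m, n))^nat) :
  (forall i, <<s mx_cylinders >> (F i)) -> <<s mx_cylinders >> (\bigcup_i F i).
Proof. exact: sigma_algebra_bigcup. Qed.

HB.instance Definition _ := @isMeasurable.Build (measure_mx_display d)
  'M[T]_(m, n) <<s mx_cylinders >> mx_set0 mx_setC mx_bigcup.

End measurable_mx.

Lemma measurable_fun_mx d d' (S : measurableType d') (T : measurableType d)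
    m n (f : S -> 'M[T]_(m, n)) :
  (forall i j, measurable_fun setT (fun x => f x i j)) -> measurable_fun setT f.
Proof.
move=> mf; apply: (@measurability _ _ _ _ setT f (@mx_cylinders d T m n)) => //.
move=> _ [_ [p _ [B mB <-]] <-].
by rewrite setTI; apply: mf.
Qed.

(** [n]-fold power of a sigma-finite measure, on [n]-tuples. *)

Lemma product_measure1_sigma_finite d1 d2 (T1 : measurableType d1)
    (T2 : measurableType d2) (R : realType)
    (m1 : {sigma_finite_measure set T1 -> \bar R})
    (m2 : {sigma_finite_measure set T2 -> \bar R}) :
  sigma_finite setT (m1 \x m2)%E.
Proof.
have /sigma_finiteP[F [TF ndF Foo]] := sigma_finiteT m1.
have /sigma_finiteP[G [TG ndG Goo]] := sigma_finiteT m2.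
exists (fun n => F n `*` G n).
  rewrite -setXTT TF TG predeqE => -[x y]; split.
    move=> [/= [n _ Fnx] [k _ Gky]]; exists (maxn n k) => //; split.
    - by move: x Fnx; exact/subsetPset/ndF/leq_maxl.
    - by move: y Gky; exact/subsetPset/ndG/leq_maxr.
  by move=> [n _ []/= ? ?]; split; exists n.
move=> k; have [? ?] := Foo k; have [? ?] := Goo k.
split; first exact: measurableX.
by rewrite product_measure1E// lte_mul_pinfty// ge0_fin_numE.
Qed.

Section power_measure.
Context {d} {T : measurableType d} {R : realType}.

Definition cons_pair n (p : T * n.-tuple T) : n.+1.-tuple T :=
  [tuple of p.1 :: p.2].

Lemma measurable_cons_pair n : measurable_fun setT (@cons_pair n).
Proof. exact: (measurable_cons measurable_fst measurable_snd). Qed.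

Section step.
Variables (n : nat) (m1 : {sigma_finite_measure set T -> \bar R}).
Variable m2 : {sigma_finite_measure set (n.-tuple T) -> \bar R}.

Definition power_step : set (n.+1.-tuple T) -> \bar R :=
  pushforward (m1 \x m2)%E (@cons_pair n).

Let power_step0 : power_step set0 = 0%E.
Proof. by rewrite /power_step /pushforward preimage_set0; exact: measure0. Qed.

Let power_step_ge0 A : (0 <= power_step A)%E.
Proof. by rewrite /power_step /pushforward; exact: measure_ge0. Qed.

Let power_step_sigma_additive : semi_sigma_additive power_step.
Proof.
move=> F mF tF mUF; rewrite /power_step /pushforward preimage_bigcup.
apply: measure_semi_sigma_additive.
- by move=> n'; rewrite -[X in measurable X]setTI; exact: measurable_cons_pair.
- apply/trivIsetP => /= i j _ _ ij; rewrite -preimage_setI.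
  by move/trivIsetP : tF => /(_ _ _ _ _ ij) ->//; rewrite preimage_set0.
- by rewrite -preimage_bigcup -[X in measurable X]setTI;
    exact: measurable_cons_pair.
Qed.

HB.instance Definition _ := isMeasure.Build _ _ _ power_step
  power_step0 power_step_ge0 power_step_sigma_additive.

Let power_step_sigma_finite : sigma_finite setT power_step.
Proof.
have [F FT Foo] : sigma_finite setT (m1 \x m2)%E.
  exact: product_measure1_sigma_finite.
pose u (t : n.+1.-tuple T) : T * n.-tuple T := (thead t, [tuple of behead t]).
have uK : cancel (@cons_pair n) u.
  by case=> x t; rewrite /u /cons_pair theadE; congr pair; apply/val_inj.
have mu_ : measurable_fun setT u.
  apply/measurable_fun_pairP; split => //=.
    exact: measurable_tnth.
  exact: measurable_behead.
exists (fun k => u @^-1` F k).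
  by rewrite -preimage_bigcup -FT preimage_setT.
move=> k; have [mF Fk] := Foo k; split.
  by rewrite -[X in measurable X]setTI; exact: mu_.
rewrite /power_step /pushforward (_ : _ @^-1` _ = F k)//.
by apply/seteqP; split=> x /=; rewrite uK.
Qed.

HB.instance Definition _ :=
  Measure_isSigmaFinite.Build _ _ _ power_step power_step_sigma_finite.

End step.

Fixpoint power_measure (mu : {sigma_finite_measure set T -> \bar R}) n :
    {sigma_finite_measure set (n.-tuple T) -> \bar R} :=
  if n isn't n'.+1 then \d_([tuple] : 0.-tuple T)
  else power_step mu (power_measure mu n').

End power_measure.

(** Lebesgue measure [dX = \prod_(i <= j) dx_ij] on symmetric matrices.  It is
    carried by the type of all square matrices, and concentrated on the
    symmetric ones. *)

Definition triu_index m := {p : 'I_m * 'I_m | (p.1 <= p.2)%N}.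

Lemma triu_index_subproof m (i j : 'I_m) :
  ((Order.min i j, Order.max i j).1 <= (Order.min i j, Order.max i j).2)%N.
Proof. by rewrite /=; case: (leP i j) => [//|/ltW]. Qed.

Definition triu_of m (i j : 'I_m) : triu_index m :=
  exist _ (Order.min i j, Order.max i j) (triu_index_subproof i j).

Section sym_lebesgue.
Variables (R : realType) (m : nat).

(** The entries [x_ij], [i <= j], are read off the tuple; the measure does not
    depend on their enumeration. *)
Definition symmx_of_tuple (t : #|{: triu_index m}|.-tuple (measurableTypeR R)) :
    'M[R]_m :=
  \matrix_(i, j) tnth t (enum_rank (triu_of i j)).

Lemma measurable_symmx_of_tuple : measurable_fun setT symmx_of_tuple.
Proof.
apply: measurable_fun_mx => i j.
rewrite (_ : (fun _ => _) = fun t => tnth t (enum_rank (triu_of i j))).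
  exact: measurable_tnth.
by apply/funext => t; rewrite mxE.
Qed.

Definition sym_lebesgue : set 'M[R]_m -> \bar R :=
  pushforward (power_measure (@lebesgue_measure R) #|{: triu_index m}|)
              symmx_of_tuple.

Let sym_lebesgue0 : sym_lebesgue set0 = 0%E.
Proof. by rewrite /sym_lebesgue /pushforward preimage_set0 measure0. Qed.

Let sym_lebesgue_ge0 A : (0 <= sym_lebesgue A)%E.
Proof. by rewrite /sym_lebesgue /pushforward; exact: measure_ge0. Qed.

Let sym_lebesgue_sigma_additive : semi_sigma_additive sym_lebesgue.
Proof.
move=> F mF tF mUF; rewrite /sym_lebesgue /pushforward preimage_bigcup.
apply: measure_semi_sigma_additive.
- by move=> n; rewrite -[X in measurable X]setTI;
    exact: measurable_symmx_of_tuple.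
- apply/trivIsetP => /= i j _ _ ij; rewrite -preimage_setI.
  by move/trivIsetP : tF => /(_ _ _ _ _ ij) ->//; rewrite preimage_set0.
- by rewrite -preimage_bigcup -[X in measurable X]setTI;
    exact: measurable_symmx_of_tuple.
Qed.

HB.instance Definition _ := isMeasure.Build _ _ _ sym_lebesgue
  sym_lebesgue0 sym_lebesgue_ge0 sym_lebesgue_sigma_additive.

End sym_lebesgue.

Section posdef.
Variables (R : realType) (m : nat).
Implicit Types A B X : 'M[R]_m.

Definition posdefmx A : Prop :=
  A^T = A /\ forall v : 'rV[R]_m, v != 0 -> 0 < (v *m A *m v^T) 0 0.

Definition loewner_lt A B : Prop := posdefmx (B - A).

(** The positive definite square root; [0] when there is none. *)
Definition posdef_sqrt A : 'M[R]_m :=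
  xget 0 [set S | posdefmx S /\ S *m S = A].

Definition posdef_cone : set 'M[R]_m := [set X | posdefmx X].

Definition posdef_unit : set 'M[R]_m :=
  [set X | posdefmx X /\ posdefmx (1%:M - X)].

End posdef.

(** [R[i]] behind an alias, for its normed-module instances to be found. *)
Definition CC (R : realType) : numClosedFieldType := R[i].

Section complex_functions.
Variable R : realType.

Definition toC : R -> CC R := fun x => x%:C%C.

(** [x ^ z = exp (z ln x)], meant for [0 < x]. *)
Definition cpow (x : R) (z : CC R) : CC R :=
  let r := expR (complex.Re z * ln x) in
  let t := complex.Im z * ln x in
  (r * cos t +i* (r * sin t))%C.

Definition borel_fun (h : CC R -> CC R) : Prop :=
  measurable_fun setT (h : g_sigma_algebraType (@open (CC R)) ->
                           g_sigma_algebraType (@open (CC R))).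

(** All complex derivatives of [h] exist around [0] (so that the totalized
    [derive1n t h 0] is the actual [h^(t)(0)]), and the Taylor series of [h] at
    [0] converges to [h] on [D]. *)
Definition taylor_on (h : CC R -> CC R) (D : set (CC R)) : Prop :=
  (forall t, \forall z \near (0 : CC R), derivable (derive1n t h) z 1) /\
  (forall z, D z ->
     series (fun t => derive1n t h 0 / t`!%:R * z ^+ t) @ \oo --> h z).

End complex_functions.

(** [f], extended by [0] outside of [D], is a density of the random symmetric
    matrix [Y].  The formula [f] is complex-valued since its parameters are; to
    be a density it has to take real nonnegative values, which is what [0 <= _]
    means in [R[i]]. *)
Definition has_density d (T : measurableType d) (R : realType)
    (P : probability T R) m (Y : T -> 'M[R]_m) (D : set 'M[R]_m)
    (f : 'M[R]_m -> CC R) : Prop :=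
  [/\ measurable_fun setT Y,
      forall w, (Y w)^T = Y w,
      measurable_fun D (fun X => complex.Re (f X)),
      forall X, D X -> 0 <= f X &
      forall A, measurable A ->
        P (Y @^-1` A) =
        (\int[@sym_lebesgue R m]_(X in A `&` D) (complex.Re (f X))%:E)%E].

Section MBG.
Variables (R : realType) (m : nat) (a b : CC R) (h : CC R -> CC R).
Variable Phi : 'M[CC R]_m.
Implicit Types X : 'M[R]_m.

Let p : CC R := m.+1%:R / 2.

Definition mbg_kernel1 X : CC R :=
  cpow (\det X) (a - p) * cpow (\det (1%:M - X)) (b - p) *
  h (\tr (Phi *m map_mx (@toC R) X)).

Definition mbg_kernel2 X : CC R :=
  cpow (\det X) (a - p) * cpow (\det (1%:M + X)) (- (a + b)) *
  h (\tr (Phi *m map_mx (@toC R) X)).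

Definition mbg_kernel3 X : CC R :=
  cpow (\det X) (a - p) * cpow (\det (1%:M - X)) (b - p) *
  cpow (\det (1%:M + X)) (- (a + b)) *
  h (\tr (Phi *m map_mx (@toC R) X)).

(** The inverse of the complex integral of [g] over [D].  If [g] is not
    integrable, or has integral [0], then no random matrix has density
    [normalizing_const D g * g X]. *)
Definition normalizing_const (D : set 'M[R]_m) (g : 'M[R]_m -> CC R) : CC R :=
  (((\int[@sym_lebesgue R m]_(X in D) complex.Re (g X)) +i*
    (\int[@sym_lebesgue R m]_(X in D) complex.Im (g X)))%C : CC R)^-1.

Definition mbg_zeta1 := normalizing_const (@posdef_unit R m) mbg_kernel1.
Definition mbg_zeta2 := normalizing_const (@posdef_cone R m) mbg_kernel2.
Definition mbg_zeta3 := normalizing_const (@posdef_unit R m) mbg_kernel3.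

Definition taylor_on_support (D : set 'M[R]_m) : Prop :=
  taylor_on h [set \tr (Phi *m map_mx (@toC R) X) | X in D].

Context {d} {T : measurableType d}.
Variable P : probability T R.

Definition MBG1 (X : T -> 'M[R]_m) : Prop :=
  taylor_on_support (@posdef_unit R m) /\
  has_density P X (@posdef_unit R m) (fun Z => mbg_zeta1 * mbg_kernel1 Z).

Definition MBG2 (X : T -> 'M[R]_m) : Prop :=
  taylor_on_support (@posdef_cone R m) /\
  has_density P X (@posdef_cone R m) (fun Z => mbg_zeta2 * mbg_kernel2 Z).

Definition MBG3 (X : T -> 'M[R]_m) : Prop :=
  taylor_on_support (@posdef_unit R m) /\
  has_density P X (@posdef_unit R m) (fun Z => mbg_zeta3 * mbg_kernel3 Z).

End MBG.

(* Main.v *)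
Require Import Defs.
From HB Require Import structures.
From mathcomp Require Import all_boot all_order all_algebra.
From mathcomp Require Import complex.
From mathcomp Require Import all_classical all_reals all_analysis.
From mathcomp Require Import measurable_realfun ring.
Set Implicit Arguments.
Unset Strict Implicit.
Unset Printing Implicit Defensive.
Import Order.TTheory GRing.Theory Num.Theory numFieldNormedType.Exports.
Local Open Scope classical_set_scope.
Local Open Scope ring_scope.

(** Every [Y_i] is the image of [X_i] under [G X = S X S + Psi], where [S] is the
    positive definite square root of [Omega - Psi], so that the theorem is a
    change of variables.  Three facts make it work.

    - The Jacobian: [G] multiplies the Lebesgue measure of symmetric matrices by
      [(det S)^(m+1)].  Congruences by diagonal matrices and by transvections
      are read off the entries, one coordinate at a time, by Fubini's theorem
      ([power_measure_update], [scales_update_entries]); and positive definite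
      matrices are products of such matrices, by iterated Schur complements
      ([posdefmx_gen]).  Hence [scales_congr_posdef].

    - The algebra: with [Y = G X], the matrices [Y - Psi], [Omega - Y] and
      [Omega + Y - 2 Psi] are the congruences by [S] of [X], [I - X] and
      [I + X].  Congruence by an invertible matrix preserves positive
      definiteness, which matches the supports, and multiplies determinants by
      [det (Omega - Psi)]; in each of the three cases the powers of that
      determinant add up to [- (m+1) / 2], which is the Jacobian factor.
      Cyclicity of the trace turns [Theta] into [Phi].

    - The existence of [S] ([posdef_sqrtP]), from the spectral theorem, and the
      measurability of the cone of positive definite matrices
      ([measurable_posdefmx]), which the change of variables in the integral
      requires ([has_density_image]). *)

(** * Affine updates of one coordinate *)

(** The measure structure of a pushforward depends on the measurability of the
    map, which inference cannot find; here it is an argument. *)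
Definition pushforward_measure d d' (T1 : measurableType d) (T2 : measurableType d')
    (R : realFieldType) (mu : {measure set T1 -> \bar R}) (f : T1 -> T2)
    (mf : measurable_fun setT f) : {measure set T2 -> \bar R}.
Proof. by unshelve refine (pushforward mu f : measure _ _). Defined.

(** Both sides are measures in [A] up to the factor [|c|], so they need only be
    compared on half-open intervals. *)
Lemma lebesgue_affine_preimage (R : realType) (c e : R)
    (A : set (measurableTypeR R)) : c != 0 -> measurable A ->
  lebesgue_measure ((fun x => c * x + e) @^-1` A) =
    (`|c|^-1%:E * lebesgue_measure A)%E.
Proof.
move=> c0 mA.
pose F : measurableTypeR R -> measurableTypeR R := fun x => c * x + e.
have mF : measurable_fun setT F.
  by apply: measurable_realfun.measurable_funD => //; exact: measurable_funM.
pose nu : measure (measurableTypeR R) R :=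
  mscale (NngNum (normr_ge0 c)) (pushforward_measure (@lebesgue_measure R) mF).
suff -> : lebesgue_measure A = nu A.
  by rewrite /nu /= /mscale /= /pushforward muleA -EFinM mulVf ?mul1e// normr_eq0.
apply: (@lebesgue_measure_unique _ nu _ _ mA) => _ [[x y] _ <-] /=.
rewrite /nu /= /mscale /= /pushforward /F.
have [c_gt0|c_lt0] : 0 < c \/ c < 0 by apply/orP; rewrite orbC -neq_lt.
- have -> : (fun x => c * x + e) @^-1` [set` `]x, y]] =
      [set` `](x - e) / c, (y - e) / c]].
    by apply/seteqP; split=> z /=; rewrite !in_itv /= ltr_pdivrMr// ler_pdivlMr//
      ltrBlDr lerBrDr (mulrC z).
  rewrite !lebesgue_measure_itv /= !lte_fin ltr_pM2r ?invr_gt0// ltrD2r.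
  case: ifP => _; last by rewrite mule0.
  by rewrite gtr0_norm// -!EFinB -EFinM; congr EFin; field.
- have -> : (fun x => c * x + e) @^-1` [set` `]x, y]] =
      [set` `[(y - e) / c, (x - e) / c[].
    by apply/seteqP; split=> z /=; rewrite !in_itv /= ltr_ndivlMr// ler_ndivrMr//
      ltrBlDr lerBrDr (mulrC z) andbC.
  rewrite !lebesgue_measure_itv /= !lte_fin ltr_nM2r ?invr_lt0// ltrD2r.
  case: ifP => _; last by rewrite mule0.
  by rewrite ltr0_norm// -!EFinB -EFinM; congr EFin; field.
Qed.

Lemma measurable_preimage d d' (T1 : measurableType d) (T2 : measurableType d')
  (f : T1 -> T2) (A : set T2) : measurable_fun setT f -> measurable A ->
  measurable (f @^-1` A).
Proof. by move=> mf mA; rewrite -[X in measurable X]setTI; exact: mf. Qed.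

(** With all other coordinates frozen, the map is affine in the [i]-th one with
    slope [c], so Fubini's theorem reduces the claim to dimension one.  The
    recursive definition of the power measure peels off the head of the tuple:
    either the head is frozen and the induction hypothesis applies to the
    section, or the head is the updated coordinate and the tail is frozen. *)
Lemma power_measure_update (R : realType) n (i : 'I_n) (c : R)
    (g : n.-tuple (measurableTypeR R) -> measurableTypeR R)
    (F : n.-tuple (measurableTypeR R) -> n.-tuple (measurableTypeR R)) :
  c != 0 -> measurable_fun setT F ->
  (forall t t', (forall j, j != i -> tnth t j = tnth t' j) -> g t = g t') ->
  (forall t j, tnth (F t) j = if j == i then c * tnth t j + g t else tnth t j) ->
  forall A, measurable A ->
  power_measure (@lebesgue_measure R) n (F @^-1` A) =
    (`|c|^-1%:E * power_measure (@lebesgue_measure R) n A)%E.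
Proof.
move=> c0; elim: n => [|n IH] in i g F *; first by case: i.
move=> mF gi FE A mA.
set mu := power_measure _ n in IH *.
pose K := @cons_pair _ (measurableTypeR R) n.
have mcons : measurable_fun setT K := @measurable_cons_pair _ _ n.
have mA' := measurable_preimage mcons mA.
have mFA := measurable_preimage mcons (measurable_preimage mF mA).
have tnthK x t k : tnth (K (x, t)) (lift ord0 k) = tnth t k.
  by rewrite !(tnth_nth x).
rewrite /= /power_step /pushforward -/K.
case: (unliftP ord0 i) => [k|] iE.
- rewrite /product_measure1 -ge0_integralZl//=; last first.
    exact: measurable_fun_xsection.
  apply: eq_integral => x _ /=.
  pose Fx (t : n.-tuple (measurableTypeR R)) : n.-tuple (measurableTypeR R) :=
    [tuple tnth (F (K (x, t))) (lift ord0 j) | j < n].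
  have FxE t : K (x, Fx t) = F (K (x, t)).
    apply: eq_from_tnth => j; case: (unliftP ord0 j) => [j' ->|->].
      by rewrite tnthK tnth_mktuple.
    by rewrite FE iE (negPf (neq_lift _ _)).
  have -> : xsection (K @^-1` (F @^-1` A)) x = Fx @^-1` (xsection (K @^-1` A) x).
    by apply/seteqP; split=> t /=; rewrite /xsection /= !inE /= FxE.
  apply: (IH k (fun t => g (K (x, t)))); last exact: measurable_xsection.
  + apply/measurable_fun_tnthP => j.
    rewrite (_ : _ \o _ = (fun t => tnth t (lift ord0 j)) \o F \o K \o pair x).
      apply: measurableT_comp; last exact: pair1_measurable.
      apply: measurableT_comp => //; apply: measurableT_comp => //.
      exact: measurable_tnth.
    by apply/funext => t /=; rewrite tnth_mktuple.
  + move=> t t' tt'; apply: gi => j; case: (unliftP ord0 j) => [j' ->|-> //].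
    by rewrite iE (inj_eq lift_inj) !tnthK; exact: tt'.
  + move=> t j; rewrite tnth_mktuple FE iE (inj_eq lift_inj) tnthK.
    by case: eqP => // ->.
- have swap X : measurable X ->
      product_measure1 lebesgue_measure mu X =
      (\int[mu]_y (lebesgue_measure \o ysection X) y)%E.
    move=> mX; apply: (@product_measure_unique _ _ _ _ _ lebesgue_measure mu
      (lebesgue_measure \x^ mu)%E) => // B C mB mC.
    exact: product_measure2E.
  rewrite !swap// -ge0_integralZl//=; last exact: measurable_fun_ysection.
  apply: eq_integral => y _ /=.
  rewrite -(@lebesgue_affine_preimage R c (g (K (0, y))))//; last first.
    exact: measurable_ysection.
  have FK x : F (K (x, y)) = K (c * x + g (K (0, y)), y).
    apply: eq_from_tnth => j; rewrite FE iE; case: (unliftP ord0 j) => [j' ->|->].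
      by rewrite eq_sym (negPf (neq_lift _ _)) !tnthK.
    rewrite eqxx; congr (_ + _); apply: gi => j'; rewrite iE.
    by case: (unliftP ord0 j') => [j'' ->|->]; rewrite ?eqxx// !tnthK.
  congr lebesgue_measure.
  by apply/seteqP; split=> x /=; rewrite /ysection /= !inE /= FK.
Qed.
(** * Maps that scale the Lebesgue measure of symmetric matrices *)

Section sym_maps.
Variables (R : realType) (m : nat).
Local Notation MR := ('M[R]_m).
Implicit Types (G H : MR -> MR) (k l : R).

Definition scales_sym_lebesgue (k : R) (G : MR -> MR) : Prop :=
  measurable_fun setT G /\
  forall A : set MR, measurable A ->
    sym_lebesgue (G @^-1` A) = (k%:E * sym_lebesgue A)%E.

Lemma measurable_mx_entry (i j : 'I_m) :
  measurable_fun setT (fun X : MR => X i j).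
Proof.
move=> _ B mB; rewrite setTI; apply: sub_sigma_algebra.
by exists (i, j) => //; exists B => //; rewrite setTI.
Qed.

Lemma scales_sym_lebesgue_comp k l G H : scales_sym_lebesgue k G ->
  scales_sym_lebesgue l H -> scales_sym_lebesgue (k * l) (G \o H).
Proof.
move=> [mG GE] [mH HE]; split=> [|A mA]; first exact: measurableT_comp.
rewrite comp_preimage HE; last exact: measurable_preimage.
by rewrite GE// muleA -EFinM (mulrC l).
Qed.

Lemma symmx_of_tuple_sym (t : #|{: triu_index m}|.-tuple (measurableTypeR R)) :
  (symmx_of_tuple t)^T = symmx_of_tuple t.
Proof.
apply/matrixP => i j; rewrite !mxE; congr (tnth t (enum_rank _)).
by apply/val_inj; rewrite /= minC maxC.
Qed.

(** The measure is carried by the symmetric matrices, so that only the values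
    of a map on these matter. *)
Lemma scales_sym_lebesgue_eq k G H : scales_sym_lebesgue k G ->
  measurable_fun setT H -> (forall X, X^T = X -> H X = G X) ->
  scales_sym_lebesgue k H.
Proof.
move=> [mG GE] mH HG; split=> // A mA; rewrite -GE//.
rewrite /sym_lebesgue /pushforward; congr (power_measure _ _ _).
by apply/seteqP; split=> t /=; rewrite HG//; exact: symmx_of_tuple_sym.
Qed.

Definition update_entries (J : pred (triu_index m)) (c : triu_index m -> R)
    (g : triu_index m -> MR -> R) (X : MR) : MR :=
  \matrix_(i, j) if J (triu_of i j)
    then c (triu_of i j) * X i j + g (triu_of i j) X else X i j.

Lemma measurable_update_entries (J : pred (triu_index m)) c g :
  (forall e, J e -> measurable_fun setT (g e)) ->
  measurable_fun setT (update_entries J c g).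
Proof.
move=> mg; apply: measurable_fun_mx => i j.
rewrite (_ : (fun _ => _) = fun X : MR => if J (triu_of i j)
    then c (triu_of i j) * X i j + g (triu_of i j) X else X i j); last first.
  by apply/funext => X; rewrite mxE.
have [Je|_] := boolP (J _); last exact: measurable_mx_entry.
apply: measurable_realfun.measurable_funD; last exact: mg.
by apply: measurable_funM => //; exact: measurable_mx_entry.
Qed.

Lemma scales_update_entry (e : triu_index m) c g : c e != 0 ->
  measurable_fun setT (g e) ->
  (forall X Y : MR, (forall i j, triu_of i j != e -> X i j = Y i j) ->
    g e X = g e Y) ->
  scales_sym_lebesgue `|c e|^-1 (update_entries (pred1 e) c g).
Proof.
move=> c0 mg ig.
have mG : measurable_fun setT (update_entries (pred1 e) c g).
  by apply: measurable_update_entries => _ /eqP ->.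
split=> // A mA; rewrite /sym_lebesgue /pushforward.
pose N := #|{: triu_index m}|.
pose F (t : N.-tuple (measurableTypeR R)) : N.-tuple (measurableTypeR R) :=
  [tuple if j == enum_rank e then c e * tnth t j + g e (symmx_of_tuple t)
         else tnth t j | j < N].
have FE t j : tnth (F t) j = if j == enum_rank e
    then c e * tnth t j + g e (symmx_of_tuple t) else tnth t j.
  by rewrite tnth_mktuple.
have msymmx := @measurable_symmx_of_tuple R m.
rewrite -(@power_measure_update _ _ (enum_rank e) _
    (fun t => g e (symmx_of_tuple t)) F)//.
- congr (power_measure _ _ _).
  suff FG t : symmx_of_tuple (F t) = update_entries (pred1 e) c g (symmx_of_tuple t).
    by apply/seteqP; split=> t /=; rewrite FG.
  apply/matrixP => i j; rewrite !mxE FE /= (inj_eq enum_rank_inj).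
  by case: eqP => // ->.
- apply/measurable_fun_tnthP => j.
  rewrite (_ : _ \o _ = fun t => if j == enum_rank e
    then c e * tnth t j + g e (symmx_of_tuple t) else tnth t j); last first.
    by apply/funext => t /=; rewrite FE.
  case: (j == _); last exact: measurable_tnth.
  apply: measurable_realfun.measurable_funD.
    by apply: measurable_funM => //; exact: measurable_tnth.
  exact: measurableT_comp.
- move=> t t' tt'; apply: ig => i j ije; rewrite !mxE; apply: tt'.
  by rewrite (inj_eq enum_rank_inj).
- exact: measurable_preimage.
Qed.

(** The updates can be made one entry at a time, since none of them reads an
    entry that another one changes. *)
Lemma scales_update_entries (J : pred (triu_index m)) c g :
  (forall e, J e -> c e != 0) ->
  (forall e, J e -> measurable_fun setT (g e)) ->
  (forall e (X Y : MR), J e ->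
    (forall i j, ~~ J (triu_of i j) -> X i j = Y i j) -> g e X = g e Y) ->
  scales_sym_lebesgue (\prod_(e | J e) `|c e|^-1) (update_entries J c g).
Proof.
move=> c0 mg ig.
suff step s : uniq s -> {subset s <= J} ->
    scales_sym_lebesgue (\prod_(e <- s) `|c e|^-1) (update_entries (mem s) c g).
  rewrite -big_enum /= (_ : update_entries J c g = update_entries (mem (enum J)) c g).
    by apply: step; [exact: enum_uniq|move=> e; rewrite mem_enum].
  by apply/funext => X; apply/matrixP => i j; rewrite !mxE /= mem_enum.
elim: s => [_ _|e s IH /= /andP[es us] sJ].
  rewrite big_nil (_ : update_entries _ _ _ = id).
    by split=> // A mA; rewrite preimage_id mul1e.
  by apply/funext => X; apply/matrixP => i j; rewrite mxE.
have Je : J e by apply: sJ; exact: mem_head.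
have sJ' : {subset s <= J} by move=> f fs; apply: sJ; rewrite inE fs orbT.
rewrite big_cons (_ : update_entries _ _ _ =
    update_entries (pred1 e) c g \o update_entries (mem s) c g).
  apply: scales_sym_lebesgue_comp; last exact: IH.
  apply: scales_update_entry; [exact: c0|exact: mg|].
  move=> X Y XY; apply: ig => // i j nJ; apply: XY.
  by apply: contraNneq nJ => ->.
apply/funext => X; apply/matrixP => i j; rewrite [LHS]mxE /= [RHS]mxE /= inE.
case: eqP => [ije|_] /=; last by rewrite mxE.
rewrite mxE /= ije (negPf es); congr (_ + _); apply: ig => // i' j' nJ.
by rewrite mxE /=; case: ifP => // /sJ'; rewrite unfold_in (negPf nJ).
Qed.

Definition congr_mx (M X : MR) : MR := M *m X *m M^T.

Lemma measurable_congr_mx M : measurable_fun setT (congr_mx M).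
Proof.
apply: measurable_fun_mx => i j.
rewrite (_ : (fun _ => _) = fun X : MR =>
    \sum_k (\sum_l M i l * X l k) * M j k); last first.
  by apply/funext => X; rewrite !mxE; apply: eq_bigr => k _; rewrite !mxE.
apply: (measurable_sum _) => k; apply: measurable_funM => //.
apply: (measurable_sum _) => l; apply: measurable_funM => //.
exact: measurable_mx_entry.
Qed.

Lemma triu_ofP (i j : 'I_m) :
  (val (triu_of i j) = (i, j) /\ (i <= j)%N) \/
  (val (triu_of i j) = (j, i) /\ (j <= i)%N).
Proof. by rewrite /=; case: (leP i j) => [ij|/ltW ji]; [left|right]. Qed.

Lemma triu_ofC (i j : 'I_m) : triu_of i j = triu_of j i.
Proof. by apply/val_inj; rewrite /= minC maxC. Qed.

Lemma triu_of_eq (i j k l : 'I_m) : (triu_of i j == triu_of k l) =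
  ((i == k) && (j == l)) || ((i == l) && (j == k)).
Proof.
rewrite -val_eqE; apply/eqP/orP.
  case: (triu_ofP i j) => -[-> _]; case: (triu_ofP k l) => -[-> _] [-> ->];
  by rewrite !eqxx; auto.
by case=> /andP[/eqP -> /eqP ->]; rewrite // -/(val _) triu_ofC.
Qed.

(** The index [i] occurs once in each pair [(i, j)] with [j] different from [i],
    and twice in [(i, i)]: [m + 1] times. *)
Lemma prod_triu (d : 'I_m -> R) :
  \prod_(e : triu_index m) (d (val e).1 * d (val e).2) = (\prod_i d i) ^+ m.+1.
Proof.
transitivity (\prod_(p : 'I_m * 'I_m | (p.1 <= p.2)%N) (d p.1 * d p.2)).
  rewrite [RHS](reindex_omap (val : triu_index m -> _) insub) /=.
    by apply: eq_bigl => -[p pP] /=; rewrite pP insubT eqxx.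
  by move=> p pP; rewrite insubT.
rewrite big_split /= -(pair_big_dep predT (fun i j : 'I_m => (i <= j)%N)
  (fun i _ => d i)) /=.
rewrite -(pair_big_dep predT (fun i j : 'I_m => (i <= j)%N) (fun _ j => d j)) /=.
rewrite [X in _ * X](exchange_big_dep predT) //= -big_split /= -prodrXl.
apply: eq_bigr => i _; rewrite [X in X * _]big_mkcond [X in _ * X]big_mkcond /=.
rewrite -big_split /=.
transitivity (\prod_(j < m) (d i * (if j == i then d i else 1))).
  apply: eq_bigr => j _; rewrite -val_eqE /=.
  by case: ltngtP; rewrite ?(mul1r, mulr1).
rewrite big_split /= prodr_const card_ord -big_mkcond big_pred1_eq.
by rewrite exprSr.
Qed.

Definition scales_congr M :=
  scales_sym_lebesgue (`|\det M|^-1 ^+ m.+1) (congr_mx M).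

Lemma scales_congrM M N : scales_congr M -> scales_congr N ->
  scales_congr (M *m N).
Proof.
move=> sM sN; rewrite /scales_congr det_mulmx normrM invfM exprMn.
rewrite (_ : congr_mx _ = congr_mx M \o congr_mx N).
  exact: scales_sym_lebesgue_comp.
by apply/funext => X; rewrite /congr_mx /= trmx_mul !mulmxA.
Qed.

Lemma scales_congr_diag (d : 'rV[R]_m) : (forall i, d 0 i != 0) ->
  scales_congr (diag_mx d).
Proof.
move=> d0; pose c (e : triu_index m) : R := d 0 (val e).1 * d 0 (val e).2.
rewrite /scales_congr det_diag -normfV -normrX -prodfV -prod_triu normr_prod.
rewrite (eq_bigr (fun e => `|c e|^-1)); last by move=> e _; rewrite /c -invfM normfV.
have -> : congr_mx (diag_mx d) = update_entries xpredT c (fun _ _ => 0).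
  apply/funext => X; apply/matrixP => i j.
  rewrite /congr_mx tr_diag_mx mul_mx_diag mul_diag_mx !mxE /= addr0 /c.
  by case: (triu_ofP i j) => -[-> _] /=; rewrite mulrAC// (mulrC (d 0 j)).
apply: scales_update_entries => // e _; rewrite /c mulf_neq0//.
Qed.

Lemma mul_delta_mxE (M : MR) (k l i j : 'I_m) :
  (delta_mx k l *m M) i j = M l j *+ (i == k).
Proof.
rewrite mxE (bigD1 l) //= big1 ?addr0 => [|r rl]; last first.
  by rewrite mxE (negPf rl) andbF mul0r.
by rewrite mxE eqxx andbT; case: eqP; rewrite (mul1r, mul0r).
Qed.

Lemma det_transvection (a : R) (k l : 'I_m) : k != l ->
  \det (1%:M + a *: delta_mx k l) = 1.
Proof.
wlog lk : k l / (l < k)%N => [hwlog kl|kl].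
  have := kl; rewrite -val_eqE neq_ltn => /orP[kl'|lk]; last exact: hwlog.
  rewrite -det_tr linearD /= linearZ /= trmx1 trmx_delta.
  by apply: hwlog => //; rewrite eq_sym.
rewrite det_trig; last first.
  apply/is_trig_mxP => i j ij; rewrite !mxE -val_eqE (ltn_eqF ij) add0r.
  case: eqP => [ik|]; case: eqP => [jl|]; rewrite ?mulr0//.
  by move: ij; rewrite ik jl ltnNge ltnW.
rewrite big1// => i _; rewrite !mxE eqxx.
by case: eqP => [->|]; rewrite ?(negPf kl) mulr0 addr0.
Qed.

Lemma congr_transvectionE (a : R) (k l i j : 'I_m) (X : MR) : X^T = X ->
  congr_mx (1%:M + a *: delta_mx k l) X i j =
    X i j + a * X l j *+ (i == k) + a * X l i *+ (j == k) +
    a ^+ 2 * X l l *+ ((i == k) && (j == k)).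
Proof.
move=> Xsym.
have XC i' j' : X i' j' = X j' i' by rewrite -[in LHS]Xsym mxE.
set E := _ + _.
have EX (Y : MR) i' j' : (E *m Y) i' j' = Y i' j' + a * Y l j' *+ (i' == k).
  by rewrite /E mulmxDl mul1mx -scalemxAl mxE [X in _ + X]mxE mul_delta_mxE mulrnAr.
have -> : congr_mx E X i j = (E *m (E *m X)^T)^T i j.
  by rewrite trmx_mul trmxK.
rewrite mxE EX [in X in X + _]mxE [in X in _ + X]mxE !EX (XC i l).
by case: (i == k); case: (j == k); rewrite /= ?mulr0n ?mulr1n; ring.
Qed.

(** Congruence by [I + a E_kl] is a composition of two triangular maps: first
    the entry [(k, k)] is shifted by a function of row [l], then the other
    entries of row and column [k] are shifted by multiples of entries of row
    [l] that are outside of row and column [k].  Neither shift changes the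
    volume. *)
Lemma scales_congr_transvection (a : R) (k l : 'I_m) : k != l ->
  scales_congr (1%:M + a *: delta_mx k l).
Proof.
move=> kl; rewrite /scales_congr det_transvection// normr1 invr1 expr1n.
pose ekk := triu_of k k.
(* [J] holds for the entries of row or column [k] other than [(k, k)]. *)
pose other (e : triu_index m) := if (val e).1 == k then (val e).2 else (val e).1.
pose J (e : triu_index m) := ((val e).1 == k) (+) ((val e).2 == k).
pose G1 := update_entries (pred1 ekk) (fun=> 1)
  (fun _ X => a * (X l k + X l k) + a ^+ 2 * X l l).
pose G2 := update_entries J (fun=> 1) (fun e X => a * X l (other e)).
have JE i j : J (triu_of i j) = (i == k) (+) (j == k).
  by rewrite /J; case: (triu_ofP i j) => -[-> _] //=; rewrite addbC.
have otherE i j : J (triu_of i j) -> other (triu_of i j) = if i == k then j else i.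
  rewrite JE /other; case: (triu_ofP i j) => -[-> _] //=.
  by case: eqP => [->|]; case: eqP => // ->.
apply: (@scales_sym_lebesgue_eq _ (G2 \o G1)); last 1 first.
- move=> X Xsym; apply/matrixP => i j.
  have XC i' j' : X i' j' = X j' i' by rewrite -[in LHS]Xsym mxE.
  have G1E i' j' : G1 X i' j' = X i' j' +
      (a * (X l k + X l k) + a ^+ 2 * X l l) *+ ((i' == k) && (j' == k)).
    rewrite mxE /= triu_of_eq orbb.
    by case: ifP => _; rewrite ?mulr0n ?mulr1n ?addr0 ?mul1r.
  rewrite congr_transvectionE//= [RHS]mxE JE.
  case: ifPn => [ijk|]; rewrite ?otherE ?JE// !G1E.
    rewrite (eq_sym l k) (negPf kl) /=.
    move: ijk; case: (i == k); case: (j == k) => //= _;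
    by rewrite ?mulr0n ?mulr1n; ring.
  case: eqP => [->|_]; case: eqP => [->|_] //= _;
  by rewrite ?mulr0n ?mulr1n ?(XC l k); ring.
- rewrite -[1]mulr1; apply: scales_sym_lebesgue_comp.
  + rewrite -[X in scales_sym_lebesgue X](_ : \prod_(e | J e) `|1|^-1 = 1); last first.
      by rewrite big1// normr1 invr1.
    apply: (scales_update_entries (c := fun=> 1)) => [e _|e _|e X Y Je XY].
    * exact: oner_neq0.
    * by apply: measurable_funM => //; exact: measurable_mx_entry.
    * congr (_ * _); apply: XY; rewrite JE (eq_sym l k) (negPf kl) /=.
      by move: Je; rewrite /J /other; case: ifPn.
  + rewrite -[X in scales_sym_lebesgue X]invr1 -[X in X^-1]normr1.
    apply: (@scales_update_entry ekk (fun=> 1)) => [||X Y XY].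
    * exact: oner_neq0.
    * apply: measurable_realfun.measurable_funD;
        apply: measurable_funM => //; last exact: measurable_mx_entry.
      by apply: measurable_realfun.measurable_funD; exact: measurable_mx_entry.
    * by rewrite !XY// triu_of_eq (eq_sym l k) (negPf kl).
- exact: measurable_congr_mx.
Qed.

Lemma scales_translation (C : MR) : C^T = C ->
  scales_sym_lebesgue 1 (fun X => X + C).
Proof.
move=> Csym.
rewrite -[X in scales_sym_lebesgue X](_ : \prod_(e : triu_index m) `|1|^-1 = 1); last first.
  by rewrite big1// normr1 invr1.
have -> : (fun X : MR => X + C) =
    update_entries xpredT (fun=> 1) (fun e _ => C (val e).1 (val e).2).
  apply/funext => X; apply/matrixP => i j; rewrite !mxE mul1r.
  by case: (triu_ofP i j) => -[-> _] //=; rewrite -[in LHS]Csym mxE.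
by apply: (scales_update_entries (c := fun=> 1)) => // e _; exact: oner_neq0.
Qed.

End sym_maps.
(** * Positive definite matrices: congruence, Schur complement, generation *)

Section posdef_theory.
Variable R : realType.

Lemma posdefmx_unit n (A : 'M[R]_n) : posdefmx A -> A \in unitmx.
Proof.
move=> [_ Apos]; rewrite -row_free_unit -kermx_eq0; apply/negPn/negP => kA0.
have /rowV0Pn[v /sub_kermxP vA v0] := kA0.
by have := Apos _ v0; rewrite vA mul0mx mxE ltxx.
Qed.

Lemma posdefmx_congr n (M A : 'M[R]_n) : M \in unitmx -> posdefmx A ->
  posdefmx (M *m A *m M^T).
Proof.
move=> Mu [Asym Apos]; split=> [|v v0]; first by rewrite !trmx_mul trmxK Asym mulmxA.
rewrite -!mulmxA -trmx_mul mulmxA mulmxA; apply: Apos.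
by apply: contraNneq v0 => vM; rewrite -(mulmxK Mu v) vM mul0mx.
Qed.

Lemma posdefmx_congrE n (M A : 'M[R]_n) : M \in unitmx ->
  posdefmx (M *m A *m M^T) <-> posdefmx A.
Proof.
move=> Mu; split; last exact: posdefmx_congr.
move=> /(@posdefmx_congr _ (invmx M)); rewrite unitmx_inv => /(_ Mu).
by rewrite trmx_inv !mulmxA mulVmx// mul1mx mulmxK// unitmx_tr.
Qed.

Lemma posdefmx_block n (a : R) (B : 'M[R]_n) :
  posdefmx (block_mx a%:M 0 0 B : 'M[R]_(1 + n)) <-> 0 < a /\ posdefmx B.
Proof.
have quad (x : 'rV[R]_1) (y : 'rV[R]_n) : (row_mx x y *m block_mx a%:M 0 0 B *m
    (row_mx x y)^T) 0 0 = a * x 0 0 ^+ 2 + (y *m B *m y^T) 0 0.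
  rewrite mul_row_block !mulmx0 add0r addr0 tr_row_mx mul_row_col mxE; congr (_ + _).
  by rewrite mul_mx_scalar -scalemxAl !mxE big_ord1 mxE expr2.
split=> [[sym pos]|[a_gt0 [Bsym Bpos]]].
- split.
    have /pos : row_mx (const_mx 1 : 'rV[R]_1) (0 : 'rV[R]_n) != 0.
      by rewrite row_mx_eq0 negb_and; apply/orP; left; apply/eqP => /matrixP/(_ 0 0);
        rewrite !mxE => /eqP; rewrite oner_eq0.
    by rewrite quad !mul0mx !mxE expr1n mulr1 addr0.
  split=> [|v v0].
    by move: sym; rewrite tr_block_mx => /eq_block_mx[].
  have /pos : row_mx (0 : 'rV[R]_1) v != 0 by rewrite row_mx_eq0 (negPf v0) andbF.
  by rewrite quad !mxE expr0n mulr0 add0r.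
- split=> [|v]; first by rewrite tr_block_mx tr_scalar_mx !trmx0 Bsym.
  rewrite -[v]hsubmxK row_mx_eq0 negb_and quad => v0.
  have [y0|y0] := eqVneq (rsubmx v) 0.
    move: v0; rewrite y0 eqxx orbF !mul0mx [X in _ + X]mxE addr0 => x0.
    rewrite pmulr_rgt0// lt0r sqr_ge0 andbT sqrf_eq0.
    by apply: contraNneq x0 => x0; apply/eqP/matrixP => i j; rewrite !ord1 x0 mxE.
  by apply: ltr_wpDl; [rewrite mulr_ge0 ?sqr_ge0 ?ltW|exact: Bpos].
Qed.

Definition unit_lower n (w : 'cV[R]_n) : 'M[R]_(1 + n) := block_mx 1%:M 0 w 1%:M.

Lemma unit_lower_unit n (w : 'cV[R]_n) : unit_lower w \in unitmx.
Proof. by rewrite unitmxE det_lblock !det1 mulr1 unitr1. Qed.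

Definition schur n (A : 'M[R]_(1 + n)) : 'M[R]_n :=
  drsubmx A - (A 0 0)^-1 *: (dlsubmx A *m ursubmx A).

(** One step of the LDL^T decomposition. *)
Lemma schur_factor n (A : 'M[R]_(1 + n)) : A^T = A -> A 0 0 != 0 ->
  let L := unit_lower ((A 0 0)^-1 *: dlsubmx A) in
  A = L *m block_mx (A 0 0)%:M 0 0 (schur A) *m L^T.
Proof.
move=> Asym a0 L; set a := A 0 0 in a0 L *.
have Aul : ulsubmx A = a%:M.
  apply/matrixP => i j; rewrite !ord1 !mxE eqxx mulr1n.
  by congr (A _ _); apply/val_inj.
have Aur : ursubmx A = (dlsubmx A)^T by rewrite trmx_dlsub Asym.
rewrite /unit_lower tr_block_mx !mulmx_block !trmx1 !trmx0.
rewrite !(mul0mx, mulmx0, mul1mx, mulmx1, addr0, add0r).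
rewrite mul_mx_scalar scalerA divff// scale1r linearZ /= mul_scalar_mx.
rewrite scalerA divff// scale1r -Aur -scalemxAr addrC subrK -Aul.
by rewrite submxK.
Qed.

Lemma posdefmx_schur n (A : 'M[R]_(1 + n)) :
  posdefmx A <-> [/\ A^T = A, 0 < A 0 0 & posdefmx (schur A)].
Proof.
have fac : A^T = A -> A 0 0 != 0 ->
    posdefmx A <-> posdefmx (block_mx (A 0 0)%:M 0 0 (schur A) : 'M[R]_(1 + n)).
  move=> Asym a0; rewrite [X in posdefmx X](schur_factor Asym a0).
  by apply: posdefmx_congrE; exact: unit_lower_unit.
split=> [Apos|[Asym a0]]; last first.
  by move=> Spos; apply/fac => //; [rewrite gt_eqF|apply/posdefmx_block].
have [Asym pos] := Apos.
have a_gt0 : 0 < A 0 0.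
  have := pos (delta_mx 0 0); rewrite -rowE trmx_delta -colE !mxE; apply.
  by apply/eqP => /matrixP/(_ 0 0); rewrite !mxE eqxx => /eqP; rewrite oner_eq0.
by have /posdefmx_block[] := (fac Asym (lt0r_neq0 a_gt0)).1 Apos.
Qed.

Lemma drblock_delta_mx n (k l : 'I_n) :
  block_mx 0 0 0 (delta_mx k l) = delta_mx (rshift 1 k) (rshift 1 l) :> 'M[R]_(1 + n).
Proof.
apply/matrixP => i j; rewrite [RHS]mxE.
by case: (split_ordP i) => i' ->; case: (split_ordP j) => j' ->;
  rewrite !(block_mxEul, block_mxEur, block_mxEdl, block_mxEdr) !mxE
    ?eq_rshift ?eq_lrshift ?andbF.
Qed.

Lemma dlblock_delta_mx n (k : 'I_n) :
  block_mx 0 0 (delta_mx k 0) 0 = delta_mx (rshift 1 k) (lshift n 0) :> 'M[R]_(1 + n).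
Proof.
apply/matrixP => i j; rewrite [RHS]mxE.
by case: (split_ordP i) => i' ->; case: (split_ordP j) => j' ->;
  rewrite !(block_mxEul, block_mxEur, block_mxEdl, block_mxEdr) !mxE
    ?eq_rshift ?eq_lshift ?eq_rlshift ?eq_lrshift ?andbF.
Qed.

Lemma unit_lower_gen n (P : 'M[R]_(1 + n) -> Prop) :
  (forall M N, P M -> P N -> P (M *m N)) -> P 1%:M ->
  (forall (a : R) i, P (1%:M + a *: delta_mx (rshift 1 i) (lshift n 0))) ->
  forall w, P (unit_lower w).
Proof.
move=> PM P1 Ptrans w.
have lowD w1 w2 : unit_lower (w1 + w2) = unit_lower w1 *m unit_lower w2.
  by rewrite /unit_lower mulmx_block !(mul0mx, mulmx0, mul1mx, mulmx1, addr0, add0r).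
rewrite (matrix_sum_delta w).
apply: (big_ind (fun w => P (unit_lower w))) => [|w1 w2 Pw1 Pw2|i _].
- by rewrite /unit_lower -scalar_mx_block.
- by rewrite lowD; exact: PM.
- rewrite big_ord1 (_ : unit_lower _ =
      1%:M + w i 0 *: delta_mx (rshift 1 i) (lshift n 0)) //.
  rewrite -dlblock_delta_mx scale_block_mx [in RHS]scalar_mx_block add_block_mx.
  by rewrite !scaler0 !(addr0, add0r).
Qed.

(** Elimination of the first row and column factors a positive definite matrix
    into block-unitriangular matrices, which are products of transvections, a
    diagonal matrix and a smaller positive definite block, the Schur
    complement.  Pivots are positive, so no permutation is needed. *)
Lemma posdefmx_gen n (P : 'M[R]_n -> Prop) :
  (forall M N, P M -> P N -> P (M *m N)) ->
  (forall d : 'rV[R]_n, (forall i, d 0 i != 0) -> P (diag_mx d)) ->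
  (forall (a : R) (k l : 'I_n), k != l -> P (1%:M + a *: delta_mx k l)) ->
  forall A, posdefmx A -> P A.
Proof.
elim: n => [|n IH] in P *.
  move=> _ Pdiag _ A _; rewrite (flatmx0 A) -(flatmx0 (diag_mx 0)).
  by apply: Pdiag => -[].
move=> PM Pdiag Ptrans A Apos.
have [Asym a_gt0 Spos] := (posdefmx_schur A).1 Apos.
have a0 : A 0 0 != 0 by rewrite gt_eqF.
have P1 : P 1%:M by rewrite -diag_const_mx; apply: Pdiag => i; rewrite mxE oner_neq0.
have Plow w : P (unit_lower w).
  by apply: unit_lower_gen => // a i; apply: Ptrans; rewrite -val_eqE.
have Pup w : P (unit_lower w)^T.
  apply: (@unit_lower_gen _ (fun M => P M^T)) => [M N PMt PNt||a i].
  - by rewrite trmx_mul; exact: PM.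
  - by rewrite trmx1.
  - rewrite linearD /= linearZ /= trmx1 trmx_delta.
    by apply: Ptrans; rewrite -val_eqE.
rewrite (schur_factor Asym a0); apply: (PM) => //; apply: (PM) => //.
rewrite (_ : block_mx _ _ _ _ = diag_mx (row_mx (A 0 0)%:M (const_mx 1)) *m
  block_mx 1%:M 0 0 (schur A)); last first.
  rewrite diag_mx_row mulmx_block !(mul0mx, mulmx0, mul1mx, mulmx1, addr0, add0r).
  rewrite diag_const_mx mul1mx; congr block_mx.
  by apply/matrixP => i j; rewrite !ord1 !mxE eqxx.
apply: (PM).
  apply: Pdiag => i; case: (@split_ordP 1 n i) => j ->.
    by rewrite (@row_mxEl R 1 1 n) ord1 mxE eqxx.
  by rewrite (@row_mxEr R 1 1 n) mxE oner_neq0.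
apply: (IH (fun M => P (block_mx (1%:M : 'M[R]_1) 0 0 M))) => //.
- move=> M N PMm PN.
  rewrite (_ : block_mx _ _ _ _ = block_mx 1%:M 0 0 M *m block_mx 1%:M 0 0 N).
    exact: PM.
  by rewrite mulmx_block !(mul0mx, mulmx0, mul1mx, mulmx1, addr0, add0r).
- move=> d d0; rewrite (_ : block_mx _ _ _ _ = diag_mx (row_mx (const_mx 1) d)).
    apply: Pdiag => i; case: (@split_ordP 1 n i) => j ->.
      by rewrite (@row_mxEl R 1 1 n) mxE oner_neq0.
    by rewrite (@row_mxEr R 1 1 n).
  by rewrite diag_mx_row diag_const_mx.
- move=> a k l kl; rewrite (_ : block_mx _ _ _ _ =
      1%:M + a *: delta_mx (rshift 1 k) (rshift 1 l)).
    by apply: Ptrans; rewrite -val_eqE /= eqn_add2l.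
  rewrite -drblock_delta_mx scale_block_mx [in RHS]scalar_mx_block add_block_mx.
  by rewrite !scaler0 !(addr0, add0r).
Qed.

End posdef_theory.
(** * Measurability of the positive definite cone *)

Section posdef_measurable.
Variable R : realType.

Lemma posdefmx_scale n (c : R) (A : 'M[R]_n) : 0 < c ->
  posdefmx (c *: A) <-> posdefmx A.
Proof.
move=> c0; have scale (d : R) (B : 'M[R]_n) : 0 < d -> posdefmx B -> posdefmx (d *: B).
  move=> d0 [Bsym Bpos]; split=> [|v v0]; first by rewrite linearZ /= Bsym.
  by rewrite -scalemxAr -scalemxAl mxE mulr_gt0 ?Bpos.
split; last exact: scale.
by move=> /(scale c^-1); rewrite scalerA mulVf ?lt0r_neq0// scale1r invr_gt0; apply.
Qed.

Lemma measurable_symmx n :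
  measurable [set A : 'M[R]_n | A^T = A].
Proof.
pose f (A : 'M[R]_n) : R :=
  \sum_i \sum_j (A i j - A j i) ^+ 2.
rewrite (_ : [set _ | _] = f @^-1` [set 0]).
  apply: measurable_preimage => //.
  apply: (measurable_sum _) => i; apply: (measurable_sum _) => j.
  apply: measurable_funX; apply: measurable_funB; exact: measurable_mx_entry.
apply/seteqP; split=> A /=.
  by move=> Asym; rewrite /f big1// => i _; rewrite big1// => j _;
    rewrite -[in X in X - _]Asym mxE subrr expr0n.
have sq_ge0 i j : 0 <= (A i j - A j i) ^+ 2 by rewrite sqr_ge0.
move=> fA0; apply/matrixP => i j; rewrite mxE; apply/esym/eqP.
have row_ge0 i' : 0 <= \sum_j' (A i' j' - A j' i') ^+ 2 by rewrite sumr_ge0.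
have /psumr_eq0P Arow : \sum_i \sum_j (A i j - A j i) ^+ 2 = 0 by [].
have /psumr_eq0P Aij := Arow (fun i _ => row_ge0 i) i isT.
by rewrite -subr_eq0 -sqrf_eq0; apply/eqP/Aij.
Qed.

(** By Schur complements: positivity of the corner entry is a measurable
    condition, and the positive definiteness of the complement is one by
    induction. *)
Lemma measurable_posdefmx n :
  measurable [set A : 'M[R]_n | posdefmx A].
Proof.
elim: n => [|n IH].
  rewrite (_ : [set _ | _] = setT) //; apply/seteqP; split=> A //= _.
  split=> [|v]; first by rewrite [LHS]flatmx0 [RHS]flatmx0.
  by rewrite [v]thinmx0 eqxx.
(* The Schur complement multiplied by the corner entry: a polynomial map. *)
pose f (A : 'M[R]_n.+1) : 'M[R]_n :=
  \matrix_(i, j) (A 0 0 * A (rshift 1 i) (rshift 1 j) -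
                  A (rshift 1 i) 0 * A 0 (rshift 1 j)).
have mf : measurable_fun setT f.
  apply: measurable_fun_mx => i j.
  rewrite (_ : (fun _ => _) = fun A : 'M[R]_n.+1 => A 0 0 * A (rshift 1 i) (rshift 1 j) -
                  A (rshift 1 i) 0 * A 0 (rshift 1 j)); last first.
    by apply/funext => A; rewrite mxE.
  by apply: measurable_funB; apply: measurable_funM; exact: measurable_mx_entry.
pose pos := (fun A : 'M[R]_n.+1 => A 0 0) @^-1` `]0, +oo[.
rewrite (_ : [set _ | _] = [set A : 'M[R]_n.+1 | A^T = A] `&`
    (pos `&` f @^-1` [set A | posdefmx A])).
  apply: measurableI; first exact: measurable_symmx.
  apply: measurableI; last exact: measurable_preimage.
  by apply: measurable_preimage; first exact: measurable_mx_entry.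
have fE (A : 'M[R]_(1 + n)) : A 0 0 != 0 -> f A = A 0 0 *: schur A.
  move=> a0; apply/matrixP => i j; rewrite !mxE big_ord1 mulrBr mulVKf// !mxE.
  by congr (_ - A _ _ * A _ _); apply/val_inj.
apply/seteqP; split=> A /=.
  move=> /posdefmx_schur[Asym a0 S]; split=> //.
  rewrite /pos /= in_itv /= andbT a0; split=> //.
  by rewrite fE ?lt0r_neq0//; apply/posdefmx_scale.
rewrite /pos /= in_itv /= andbT => -[Asym [a0 fpos]].
apply/posdefmx_schur; split=> //.
by apply/(posdefmx_scale _ a0); rewrite -fE ?lt0r_neq0.
Qed.

End posdef_measurable.

(** * The positive definite square root *)

Section posdef_sqrt.
Variable R : realType.

Lemma interpolation (rs : seq R) (f : R -> R) : uniq rs ->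
  exists p : {poly R}, forall x, x \in rs -> p.[x] = f x.
Proof.
elim: rs => [|x rs IH] /=; first by exists 0.
move=> /andP[xrs /IH[p pf]]; pose q := \prod_(y <- rs) ('X - y%:P).
have qx0 : q.[x] != 0 by rewrite -[_ == 0]/(root q x) root_prod_XsubC.
exists (p + ((f x - p.[x]) / q.[x]) *: q) => y.
rewrite inE !hornerE => /orP[/eqP ->|yrs]; first by rewrite divfK// addrC subrK.
have /eqP -> : root q y by rewrite root_prod_XsubC.
by rewrite mulr0 addr0 pf.
Qed.

Lemma trmx_horner n (A : 'M[R]_n.+1) (p : {poly R}) : A^T = A ->
  (horner_mx A p)^T = horner_mx A p.
Proof.
move=> Asym; elim/poly_ind: p => [|p c IH]; first by rewrite rmorph0 trmx0.
rewrite rmorphD rmorphM /= horner_mx_X horner_mx_C linearD /= tr_scalar_mx.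
congr (_ + _); rewrite -[_ * _]/(_ *m _) trmx_mul IH Asym.
by apply/esym/comm_horner_mx.
Qed.

(** The spectral theorem in polynomial form: the minimal polynomial of a real
    symmetric matrix is split over [R] with simple roots.  Over [R[i]] the matrix
    is Hermitian, hence unitarily diagonalizable with real eigenvalues; stated
    with polynomials, the conclusion descends to [R]. *)
Lemma symmx_spectrum n (A : 'M[R]_n.+1) : A^T = A ->
  exists l : 'I_n.+1 -> R, (forall i, eigenvalue A (l i)) /\
    forall q : {poly R}, (forall i, q.[l i] = 0) -> horner_mx A q = 0.
Proof.
move=> Asym; pose C : numClosedFieldType := R[i].
pose toC_ : {rmorphism R -> C} := real_complex R.
pose AC := map_mx toC_ A.
have AC_herm : AC \is hermsymmx.
  apply: realsym_hermsym.
    apply/is_hermitianmxP; rewrite expr0 scale1r map_mx_id//.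
    by rewrite /AC map_trmx Asym.
  by apply/mxOverP => i j; rewrite mxE complex_real.
have /orthomx_spectralP ACE := hermitian_normalmx AC_herm.
have Pu := spectral_unit AC.
have /mxOverP dreal := hermitian_spectral_diag_real AC_herm.
set P := spectralmx AC in ACE Pu; set d := spectral_diag AC in ACE dreal.
pose l i := complex.Re (d 0 i).
have dE i : d 0 i = toC_ (l i) by rewrite /l /toC_ /= RRe_real// dreal.
exists l; split=> [i|q ql].
  rewrite eigenvalue_root_char -(fmorph_root toC_) map_char_poly -/AC.
  rewrite -dE -eigenvalue_root_char; apply/eigenvalueP; exists (row i P).
    by rewrite -row_mul ACE !mulmxA mulmxV// mul1mx row_mul row_diag_mx -scalemxAl -rowE.
  apply: contraTneq isT => Pi0; have := congr1 (mulmx^~ (invmx P)) Pi0.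
  rewrite rowE mulmxK// mul0mx => /matrixP/(_ 0 i); rewrite !mxE !eqxx.
  by move/eqP; rewrite oner_eq0.
apply/eqP; rewrite -(map_mx_eq0 toC_); apply/eqP.
rewrite map_horner_mx -/AC ACE horner_mx_uconjC// horner_mx_diag.
rewrite (_ : map_mx _ d = 0).
  by rewrite linear0 mulmx0 mul0mx.
by apply/rowP => i; rewrite !mxE dE horner_map /= ql.
Qed.

Lemma posdefmx1 n : posdefmx (1%:M : 'M[R]_n).
Proof.
split=> [|v v0]; first by rewrite trmx1.
rewrite mulmx1 mxE lt0r sumr_ge0 => [|i _]; last by rewrite mxE -expr2 sqr_ge0.
rewrite andbT; apply: contra_neq v0 => /psumr_eq0P vi0; apply/rowP => i.
apply/eqP; rewrite !mxE -sqrf_eq0 expr2; have := vi0 _ i isT; rewrite mxE => ->//.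
by move=> j _; rewrite mxE -expr2 sqr_ge0.
Qed.

(** Let [r] be a polynomial with [r(x)^4 = x] on the spectrum of [A] and let
    [B = r(A)].  Then [B] is symmetric with [B^4 = A], and [B^2] is a square root
    of [A], positive definite because it is the congruence of the identity by
    [B].  Fourth roots make the positivity of the root immediate. *)
Lemma posdef_sqrtP n (A : 'M[R]_n) : posdefmx A ->
  posdefmx (posdef_sqrt A) /\ posdef_sqrt A *m posdef_sqrt A = A.
Proof.
move=> Apos; apply: (@xgetPex _ 0 [set S | posdefmx S /\ S *m S = A]).
case: n => [|n] in A Apos *.
  by exists A; split=> //; rewrite [LHS]flatmx0 [RHS]flatmx0.
have [Asym pos] := Apos.
have [l [leig lann]] := symmx_spectrum Asym.
have l_gt0 i : 0 < l i.
  have /eigenvalueP[v vA v0] := leig i.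
  have [_ pos1] := posdefmx1 n.+1.
  have := pos v v0; rewrite vA -scalemxAl mxE pmulr_lgt0//.
  by have := pos1 v v0; rewrite mulmx1.
have [r rE] := interpolation (fun x => Num.sqrt (Num.sqrt x)) (undup_uniq (codom l)).
have rl i : r.[l i] ^+ 4 = l i.
  rewrite rE ?mem_undup ?codom_f// -[4%N]/(2 * 2)%N exprM.
  by rewrite !sqr_sqrtr ?sqrtr_ge0// ltW.
pose B := horner_mx A r.
have B4 : B ^+ 4 = A.
  apply/eqP; rewrite -subr_eq0 -[X in _ - X](horner_mx_X A) -rmorphXn -rmorphB /=.
  by apply/eqP/lann => i; rewrite !hornerE rl subrr.
have Bsym : B^T = B by exact: trmx_horner.
have Bu : B \in unitmx.
  by have := posdefmx_unit Apos; rewrite -B4 -![_ \in _]/(_ \is a GRing.unit) unitrX_pos.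
exists (B *m B); split.
  rewrite -{2}Bsym -{1}[B]mulmx1.
  by apply: posdefmx_congr => //; exact: posdefmx1.
by rewrite -[RHS]B4 (exprD B 2 2) expr2.
Qed.

Lemma posdefmx_det_gt0 n (A : 'M[R]_n) : posdefmx A -> 0 < \det A.
Proof.
move=> Apos; have [_ SS] := posdef_sqrtP Apos.
have := posdefmx_unit Apos; rewrite unitmxE unitfE -SS det_mulmx -expr2 => d0.
by rewrite lt0r d0 sqr_ge0.
Qed.

End posdef_sqrt.
(** * Change of variables in a density *)

Lemma scales_congr_posdef (R : realType) m (S : 'M[R]_m) : posdefmx S ->
  scales_congr S.
Proof.
apply: posdefmx_gen; [exact: scales_congrM|exact: scales_congr_diag|].
by move=> a k l kl; exact: scales_congr_transvection.
Qed.

Section density_change.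
Variables (R : realType) (m : nat).
Local Notation MR := ('M[R]_m).
Context {d} {T : measurableType d}.
Variable P : probability T R.

(** The law of [G X] gives to [A] the integral of [f] over the preimage of [A].
    On the support [k f] is [f'] composed with [G], and the pushforward of the
    Lebesgue measure by [G] is [k] times that measure; the two factors [k]
    cancel. *)
Lemma has_density_image (k : R) (G H : MR -> MR) (D D' : set MR)
    (f f' : MR -> CC R) (X : T -> MR) :
  0 < k -> scales_sym_lebesgue k G -> measurable_fun setT H ->
  cancel G H -> cancel H G -> (forall Z, Z^T = Z -> (G Z)^T = G Z) ->
  measurable D -> (forall Z, D' (G Z) <-> D Z) ->
  (forall Z, D Z -> f' (G Z) = toC k * f Z) ->
  has_density P X D f -> has_density P (G \o X) D' f'.
Proof.
move=> k0 [mG GE] mH GK HK Gsym mD DG fG [mX Xsym mf f0 PX].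
have D'E : D' = H @^-1` D.
  by apply/seteqP; split=> Y /=; rewrite -DG HK.
have mD' : measurable D' by rewrite D'E; exact: measurable_preimage.
have fH Y : D' Y -> f' Y = toC k * f (H Y).
  by move=> D'Y; rewrite -{1}(HK Y) fG// -DG HK.
have ReM Z : complex.Re (toC k * f Z) = k * complex.Re (f Z).
  by rewrite /toC; case: (f Z) => x y /=; rewrite mul0r subr0.
have mf' : measurable_fun D' (fun Y => complex.Re (f' Y)).
  apply: (eq_measurable_fun (fun Y => k * complex.Re (f (H Y)))).
    by move=> Y; rewrite inE => D'Y; rewrite fH// ReM.
  apply: measurable_funM => //.
  apply: (measurable_comp (F := D) (f := fun Z => complex.Re (f Z))) => //.
    by move=> _ /= [Y D'Y <-]; move: D'Y; rewrite D'E.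
  exact: measurable_funTS.
have f'0 Y : D' Y -> 0 <= f' Y.
  move=> D'Y; rewrite fH// mulr_ge0//; first by rewrite /toC lecR ltW.
  by apply: f0; rewrite -DG HK.
have Ref0 (z : CC R) : 0 <= z -> 0 <= complex.Re z.
  by case: z => x y; rewrite lecE /= => /andP[].
split=> //; [exact: measurableT_comp|by move=> w /=; rewrite Gsym|].
move=> A mA.
have mE : measurable (A `&` D') by exact: measurableI.
have GED : G @^-1` (A `&` D') = G @^-1` A `&` D.
  by apply/seteqP; split=> Z /= [AZ DZ]; split=> //; apply/DG.
rewrite comp_preimage PX; last exact: measurable_preimage.
have k0' : (k != 0) by rewrite gt_eqF.
suff : (k%:E * \int[@sym_lebesgue R m]_(Z in (G @^-1` A) `&` D) (complex.Re (f Z))%:E =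
  k%:E * \int[@sym_lebesgue R m]_(Y in A `&` D') (complex.Re (f' Y))%:E)%E.
  by move=> /(congr1 (fun x => k^-1%:E * x)%E); rewrite !muleA -!EFinM mulVf// !mul1e.
transitivity (\int[pushforward_measure (@sym_lebesgue R m) mG]_(Y in A `&` D')
    (complex.Re (f' Y))%:E)%E.
- rewrite [RHS]ge0_integral_pushforward//; last first.
  + by move=> Y; rewrite inE => -[_ D'Y]; rewrite lee_fin Ref0// f'0.
  + by apply/measurable_EFinP; apply: measurable_funS mf'.
  rewrite GED -ge0_integralZl_EFin//.
  + apply: eq_integral => Z; rewrite inE => -[_ DZ] /=.
    by rewrite fG// ReM EFinM.
  + by apply: measurableI => //; exact: measurable_preimage.
  + by move=> Z [_ DZ]; rewrite lee_fin Ref0// f0.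
  + by apply/measurable_EFinP; apply: measurable_funS mf.
  + exact: ltW.
- transitivity (\int[mscale (NngNum (ltW k0)) (@sym_lebesgue R m)]_(Y in A `&` D')
    (complex.Re (f' Y))%:E)%E.
    by apply: eq_measure_integral => B mB _; exact: GE.
  rewrite ge0_integral_mscale//.
  + by apply/measurable_EFinP; apply: measurable_funS mf'.
  + by move=> Y [_ D'Y]; rewrite lee_fin Ref0// f'0.
Qed.

End density_change.

(** * Complex powers of positive numbers *)

Section cpow_theory.
Variable R : realType.
Implicit Types (x y : R) (z w : CC R).

Lemma cpowM x y z : 0 < x -> 0 < y -> cpow (x * y) z = cpow x z * cpow y z.
Proof.
move=> x0 y0; rewrite /cpow lnM ?posrE// !mulrDr expRD cosD sinD.
by apply/eqP; rewrite eq_complex /=; apply/andP; split; apply/eqP; ring.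
Qed.

Lemma cpowD x z w : cpow x (z + w) = cpow x z * cpow x w.
Proof.
case: z w => [z1 z2] [w1 w2]; rewrite /cpow /= !mulrDl expRD cosD sinD.
by apply/eqP; rewrite eq_complex /=; apply/andP; split; apply/eqP; ring.
Qed.

Lemma cpow_half x n : 0 < x ->
  cpow (x ^+ 2) (- (n%:R / 2)) = toC (x^-1 ^+ n).
Proof.
move=> x0.
have -> : - (n%:R / 2) = toC (- (n%:R / 2)) :> CC R.
  rewrite -[@toC R]/(real_complex R) rmorphN fmorph_div /= rmorph_nat.
  by rewrite rmorph_nat.
rewrite /cpow /= !mul0r cos0 sin0 mulr1 mulr0; congr (_ +i* _)%C.
rewrite lnXn//.
rewrite (_ : _ * _ = - ln x * n%:R); last first.
  by rewrite -[_ *+ 2]mulr_natr; field.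
by rewrite expRM_natr expRN lnK.
Qed.

End cpow_theory.
(** * The three densities *)

Lemma posdefmx1D (R : realType) n (A : 'M[R]_n) : posdefmx A ->
  posdefmx (1%:M + A).
Proof.
have [sym1 pos1] := posdefmx1 R n; move=> [Asym Apos].
split=> [|v v0]; first by rewrite linearD /= sym1 Asym.
by rewrite mulmxDr mulmxDl mxE addr_gt0 ?pos1 ?Apos.
Qed.

Theorem theorem3p4 (R : realType) (m : nat) (m_ge1 : (1 <= m)%N)
    (Psi Omega : 'M[R]_m)
    (Psi_pos : posdefmx Psi) (Omega_pos : posdefmx Omega)
    (Psi_lt_Omega : loewner_lt Psi Omega)
    (a b : CC R)
    (Re_a : (m%:R - 1) / 2 < complex.Re a)
    (Re_b : (m%:R - 1) / 2 < complex.Re b)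
    (Phi : 'M[CC R]_m) (Phi_sym : Phi^T = Phi)
    (h : CC R -> CC R) (h_borel : borel_fun h)
    (d : measure_display) (T : measurableType d) (P : probability T R) :
  let p : CC R := m.+1%:R / 2 in
  let S := posdef_sqrt (Omega - Psi) in
  let SinvC := map_mx (@toC R) (invmx S) in
  let Theta := SinvC *m Phi *m SinvC in
  let hTheta (Y : 'M[R]_m) := h (\tr (Theta *m map_mx (@toC R) (Y - Psi))) in
  let affine (X : T -> 'M[R]_m) := fun w => S *m X w *m S + Psi in
  [/\ forall X1 : T -> 'M[R]_m, MBG1 a b h Phi P X1 ->
        has_density P (affine X1)
          [set Y | loewner_lt Psi Y /\ loewner_lt Y Omega]
          (fun Y => mbg_zeta1 a b h Phi *
             cpow (\det (Y - Psi)) (a - p) *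
             cpow (\det (Omega - Y)) (b - p) *
             cpow (\det (Omega - Psi)) (- (a + b) + p) *
             hTheta Y),
      forall X2 : T -> 'M[R]_m, MBG2 a b h Phi P X2 ->
        has_density P (affine X2)
          [set Y | loewner_lt Psi Y]
          (fun Y => mbg_zeta2 a b h Phi *
             cpow (\det (Y - Psi)) (a - p) *
             cpow (\det (Omega + Y - 2 *: Psi)) (- (a + b)) *
             cpow (\det (Omega - Psi)) b *
             hTheta Y)
    & forall X3 : T -> 'M[R]_m, MBG3 a b h Phi P X3 ->
        has_density P (affine X3)
          [set Y | loewner_lt Psi Y /\ loewner_lt Y Omega]
          (fun Y => mbg_zeta3 a b h Phi *
             cpow (\det (Y - Psi)) (a - p) *
             cpow (\det (Omega - Y)) (b - p) *
             cpow (\det (Omega + Y - 2 *: Psi)) (- (a + b)) *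
             cpow (\det (Omega - Psi)) p *
             hTheta Y)].

Proof.
move=> p S SinvC Theta hTheta affine.
have [Spos SS] := posdef_sqrtP Psi_lt_Omega; rewrite -/S in Spos SS.
have [Ssym _] := Spos; have [Psisym _] := Psi_pos.
have Su := posdefmx_unit Spos; have detS := posdefmx_det_gt0 Spos.
set delta := \det (Omega - Psi).
have deltaE : delta = \det S ^+ 2 by rewrite /delta -SS det_mulmx expr2.
have delta_gt0 : 0 < delta by rewrite deltaE exprn_gt0.
pose k := (\det S)^-1 ^+ m.+1.
have k_gt0 : 0 < k by rewrite exprn_gt0 ?invr_gt0.
have kE : cpow delta (- p) = toC k by rewrite deltaE cpow_half.
pose G (Z : 'M[R]_m) := S *m Z *m S + Psi.
pose H (Y : 'M[R]_m) := invmx S *m (Y - Psi) *m invmx S.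
have GB Z : G Z - Psi = S *m Z *m S by rewrite /G addrK.
have OG Z : Omega - G Z = S *m (1%:M - Z) *m S.
  rewrite mulmxBr mulmxBl mulmx1 SS /G opprD addrA addrAC.
  by rewrite addrAC [RHS]addrAC addrAC.
have OGP Z : Omega + G Z - 2 *: Psi = S *m (1%:M + Z) *m S.
  rewrite mulmxDr mulmxDl mulmx1 SS /G scaler_nat mulr2n.
  by rewrite addrA opprD addrA addrK addrAC.
have scG : scales_sym_lebesgue k G.
  have -> : G = (fun X => X + Psi) \o congr_mx S.
    by apply/funext => Z; rewrite /= /congr_mx Ssym.
  rewrite -[k]mul1r /k -[X in X^-1](gtr0_norm detS); apply: scales_sym_lebesgue_comp.
    exact: scales_translation.
  exact: scales_congr_posdef.
have mH : measurable_fun setT H.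
  have -> : H = congr_mx (invmx S) \o (fun X => X - Psi).
    by apply/funext => Y; rewrite /= /congr_mx trmx_inv Ssym.
  apply: measurableT_comp; first exact: measurable_congr_mx.
  by apply: (scales_translation _).1; rewrite linearN /= Psisym.
have GK : cancel G H.
  by move=> Z; rewrite /H GB !mulmxA mulVmx// mul1mx mulmxK.
have HK : cancel H G.
  by move=> Y; rewrite /G /H !mulmxA mulmxV// mul1mx mulmxKV// subrK.
have Gsym Z : Z^T = Z -> (G Z)^T = G Z.
  by move=> Zsym; rewrite /G linearD /= !trmx_mul Ssym Psisym Zsym mulmxA.
have posG Z : posdefmx (S *m Z *m S) <-> posdefmx Z.
  by rewrite -{2}Ssym; exact: posdefmx_congrE.
have hG Z : hTheta (G Z) = h (\tr (Phi *m map_mx (@toC R) Z)).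
  rewrite /hTheta GB; congr h; rewrite /Theta /SinvC.
  rewrite -[@toC R]/(real_complex R) !map_mxM map_invmx /=.
  set SC := map_mx _ S; have SCu : SC \in unitmx by rewrite map_unitmx.
  by rewrite !mulmxA mulmxKV// mxtrace_mulC !mulmxA mulmxV// mul1mx.
have detG Z : \det (S *m Z *m S) = delta * \det Z.
  by rewrite !det_mulmx deltaE; ring.
have mcone : measurable (@posdef_cone R m) by exact: measurable_posdefmx.
have munit : measurable (@posdef_unit R m).
  have -> : @posdef_unit R m =
      @posdef_cone R m `&` (fun Z => 1%:M - Z) @^-1` @posdef_cone R m by [].
  apply: measurableI => //; apply: measurable_preimage => //.
  apply: measurable_fun_mx => i j.
  rewrite (_ : (fun _ => _) = fun Z : 'M[R]_m => (1%:M : 'M[R]_m) i j - Z i j).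
    by apply: measurable_funB => //; exact: measurable_mx_entry.
  by apply/funext => Z; rewrite !mxE.
have DU Z : [set Y | loewner_lt Psi Y /\ loewner_lt Y Omega] (G Z) <-> posdef_unit Z.
  by rewrite /= /loewner_lt GB OG !posG.
have DC Z : [set Y | loewner_lt Psi Y] (G Z) <-> posdef_cone Z.
  by rewrite /= /loewner_lt GB posG.
(* In each case the exponents of [delta] add up to [- p]. *)
split=> X [_ hX]; apply: (has_density_image k_gt0 scG mH GK HK Gsym _ _ _ hX) => //.
- move=> Z [Zpos IZpos]; rewrite GB OG !detG hG.
  rewrite !cpowM ?posdefmx_det_gt0//.
  have <- : cpow delta (a - p) * cpow delta (b - p) * cpow delta (- (a + b) + p) = toC k.
    by rewrite -kE -!cpowD; congr cpow; ring.
  by rewrite /mbg_kernel1; ring.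
- move=> Z Zpos; rewrite GB OGP !detG hG.
  rewrite !cpowM ?posdefmx_det_gt0//; last exact: posdefmx1D.
  have <- : cpow delta (a - p) * cpow delta (- (a + b)) * cpow delta b = toC k.
    by rewrite -kE -!cpowD; congr cpow; ring.
  by rewrite /mbg_kernel2; ring.
- move=> Z [Zpos IZpos]; rewrite GB OG OGP !detG hG.
  rewrite !cpowM ?posdefmx_det_gt0//; last exact: posdefmx1D.
  have <- : cpow delta (a - p) * cpow delta (b - p) * cpow delta (- (a + b)) *
      cpow delta p = toC k.
    by rewrite -kE -!cpowD; congr cpow; ring.
  by rewrite /mbg_kernel3; ring.
Qed.
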